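(* Let $\chi\colon X\to B$ be a locale map that is epic, proper and open, and let $f\colon X\to\mathbb{R}$ be any locale map. Then there is a locale map $\rho\colon B\to\mathbb{R}$ such that for all $q\in\mathbb{Q}$, $$\rho^*(q,\infty)=\chi_!\,f^*(q,\infty), \qquad \rho^*(-\infty,q)=\chi_*\,f^*(-\infty,q).$$ Moreover, let $M$ be the pullback of $(\mathrm{id}_B,\rho)\colon B\hookrightarrow B\times\mathbb{R}$ along $(\chi,f)\colon X\to B\times\mathbb{R}$. Then $M$ is a sublocale of $X$, and the induced map $M\to B$ is an epimorphism.
   Context: Work constructively: neither excluded middle nor any form of choice is assumed. Conventions on frames and locales: - A frame is a poset with finite meets and arbitrary joins satisfying $a\wedge\bigvee_i b_i=\bigvee_i a\wedge b_i$. - Locales are the opposite category of frames. - For a locale $X$, $\mathcal{O}X$ is its frame. A locale map $f\colon X\to Y$ corresponds to a frame homomorphism $f^*\colon\mathcal{O}Y\to\mathcal{O}X$, which always has a right adjoint $f_*$. - A locale map $f$ is epic iff $f^*$ is injective. Open, closed and proper maps: - A locale map $f$ is open iff $f^*$ has a left adjoint $f_!$ satisfying $f_!(f^*(b)\wedge a)=b\wedge f_!(a)$. - $f$ is closed iff $f_*(f^*(b)\vee a)=b\vee f_*(a)$ for all $a,b$. - $f$ is proper iff it is closed and $f_*$ preserves directed joins. The locale of reals $\mathbb{R}$ has frame presented by generators $(q,\infty)$ and $(-\infty,q)$ for $q\in\mathbb{Q}$, subject to the relations: - $(p,\infty)=\bigvee_{q>p}(q,\infty)$; - $(-\infty,q)=\bigvee_{p<q}(-\infty,p)$;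 - $\bigvee_{q}(q,\infty)=1=\bigvee_q(-\infty,q)$; - $(-\infty,q)\wedge(p,\infty)=0$ for $p\ge q$; - $(-\infty,q)\vee(p,\infty)=1$ for $p<q$. $(\chi,f)$ denotes the map into the product locale given by the universal property. *)

(* Defs.v *)
From mathcomp Require Import all_boot all_algebra.

Set Implicit Arguments.
Unset Strict Implicit.
Unset Printing Implicit Defensive.

Local Open Scope ring_scope.

(* Frames.  Equality of frame elements is the order-equivalence  ≈   *)
(* (so no quotient types are needed).  Arbitrary joins are joins of   *)
(* arbitrary subsets, given as predicates on the carrier.             *)

Record Frame := {
  carrier :> Type;
  le : carrier -> carrier -> Prop;
  le_refl : forall x, le x x;
  le_trans : forall x y z, le x y -> le y z -> le x z;
  top : carrier;
  le_top : forall x, le x top;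
  meet : carrier -> carrier -> carrier;
  meet_l : forall x y, le (meet x y) x;
  meet_r : forall x y, le (meet x y) y;
  meet_glb : forall x y z, le z x -> le z y -> le z (meet x y);
  join : (carrier -> Prop) -> carrier;
  join_ub : forall (S : carrier -> Prop) x, S x -> le x (join S);
  join_lub : forall (S : carrier -> Prop) y,
      (forall x, S x -> le x y) -> le (join S) y;
  (* a /\ \/_i b_i <= \/_i (a /\ b_i)  (the other inequality is automatic) *)
  distr : forall a (S : carrier -> Prop),
      le (meet a (join S)) (join (fun y => exists2 x, S x & y = meet a x))
}.

Arguments le {_} _ _.
Arguments top {_}.
Arguments meet {_} _ _.
Arguments join {_} _.

Definition feq {L : Frame} (x y : L) : Prop := le x y /\ le y x.
Notation "x ≈ y" := (feq x y) (at level 70, no associativity).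

Definition bot {L : Frame} : L := join (fun _ => False).
Definition join2 {L : Frame} (x y : L) : L := join (fun z => z = x \/ z = y).

Definition img {A B : Type} (h : A -> B) (S : A -> Prop) : B -> Prop :=
  fun y => exists2 x, S x & y = h x.

Record FrameHom (A B : Frame) := {
  hfun :> A -> B;
  hmono : forall x y, le x y -> le (hfun x) (hfun y);
  htop : hfun top ≈ top;
  hmeet : forall x y, hfun (meet x y) ≈ meet (hfun x) (hfun y);
  hjoin : forall S : A -> Prop, hfun (join S) ≈ join (img hfun S)
}.

(* Locales = opposite category of frames.                              *)

Definition Locale := Frame.
Definition O (X : Locale) : Frame := X.

Definition LMap (X Y : Locale) := FrameHom (O Y) (O X).

Definition invimg {X Y : Locale} (f : LMap X Y) : O Y -> O X := hfun f.

(* direct image f_* , the right adjoint of f^*  *)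
Definition dirimg {X Y : Locale} (f : LMap X Y) (a : O X) : O Y :=
  join (fun b => le (invimg f b) a).

Definition lid (X : Locale) : LMap X X.
Proof.
  refine (@Build_FrameHom (O X) (O X) (fun x => x) _ _ _ _) => //.
    by split; apply: le_refl.
  by move=> x y; split; apply: le_refl.
  move=> S; split.
    apply: join_lub => x Sx; apply: join_ub; by exists x.
  apply: join_lub => y [x Sx ->]; by apply: join_ub.
Defined.

Definition lmap_eq {X Y : Locale} (f g : LMap X Y) : Prop :=
  forall b, invimg f b ≈ invimg g b.

Definition comp_eq {X Y W Z : Locale}
  (g : LMap Y Z) (f : LMap X Y) (k : LMap W Z) (h : LMap X W) : Prop :=
  forall c, invimg f (invimg g c) ≈ invimg h (invimg k c).

Definition comp_is {X Y Z : Locale}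
  (g : LMap Y Z) (f : LMap X Y) (e : LMap X Z) : Prop :=
  forall c, invimg f (invimg g c) ≈ invimg e c.

Definition epic {X Y : Locale} (f : LMap X Y) : Prop :=
  forall a b : O Y, invimg f a ≈ invimg f b -> a ≈ b.

Definition left_adjoint {X Y : Locale} (f : LMap X Y) (g : O X -> O Y) : Prop :=
  forall (a : O X) (b : O Y), le (g a) b <-> le a (invimg f b).

Definition frobenius {X Y : Locale} (f : LMap X Y) (g : O X -> O Y) : Prop :=
  forall (a : O X) (b : O Y), g (meet (invimg f b) a) ≈ meet b (g a).

Definition open_map {X Y : Locale} (f : LMap X Y) : Prop :=
  exists g : O X -> O Y, left_adjoint f g /\ frobenius f g.

Definition closed_map {X Y : Locale} (f : LMap X Y) : Prop :=
  forall (a : O X) (b : O Y),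
    dirimg f (join2 (invimg f b) a) ≈ join2 b (dirimg f a).

Definition directed {L : Frame} (S : L -> Prop) : Prop :=
  (exists x, S x) /\
  (forall x y, S x -> S y -> exists2 z, S z & le x z /\ le y z).

Definition proper_map {X Y : Locale} (f : LMap X Y) : Prop :=
  closed_map f /\
  (forall S : O X -> Prop, directed S ->
     dirimg f (join S) ≈ join (img (dirimg f) S)).

Definition sublocale_embedding {M X : Locale} (m : LMap M X) : Prop :=
  forall a : O M, exists b : O X, invimg m b ≈ a.

(* Generators: Up q = (q,oo), Down q = (-oo,q), q rational.            *)

Inductive RGen := Up of rat | Down of rat.

Definition reals_relations (L : Frame) (g : RGen -> L) : Prop :=
  (forall p : rat, g (Up p) ≈ join (fun x => exists2 q : rat, p < q & x = g (Up q)))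
  /\ (forall q : rat, g (Down q) ≈ join (fun x => exists2 p : rat, p < q & x = g (Down p)))
  /\ join (fun x => exists q : rat, x = g (Up q)) ≈ top
  /\ join (fun x => exists q : rat, x = g (Down q)) ≈ top
  /\ (forall p q : rat, q <= p -> meet (g (Down q)) (g (Up p)) ≈ bot)
  /\ (forall p q : rat, p < q -> join2 (g (Down q)) (g (Up p)) ≈ top).

Record RealsLocale := {
  OR :> Locale;
  gen : RGen -> O OR;
  gen_rel : reals_relations gen;
  gen_univ : forall (L : Frame) (g : RGen -> L), reals_relations g ->
      exists h : FrameHom (O OR) L, forall x, h (gen x) ≈ g x;
  gen_uniq : forall (L : Frame) (h1 h2 : FrameHom (O OR) L),
      (forall x, h1 (gen x) ≈ h2 (gen x)) -> forall a, h1 a ≈ h2 a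
}.

Definition is_product {A B P : Locale} (p1 : LMap P A) (p2 : LMap P B) : Prop :=
  forall (Z : Locale) (z1 : LMap Z A) (z2 : LMap Z B),
    (exists u : LMap Z P, comp_is p1 u z1 /\ comp_is p2 u z2) /\
    (forall u v : LMap Z P, comp_is p1 u z1 -> comp_is p2 u z2 ->
       comp_is p1 v z1 -> comp_is p2 v z2 -> lmap_eq u v).

Definition is_pullback {X Y Z M : Locale} (c : LMap X Z) (d : LMap Y Z)
    (mX : LMap M X) (mY : LMap M Y) : Prop :=
  comp_eq c mX d mY /\
  forall (W : Locale) (wX : LMap W X) (wY : LMap W Y),
    comp_eq c wX d wY ->
    (exists u : LMap W M, comp_is mX u wX /\ comp_is mY u wY) /\
    (forall u v : LMap W M, comp_is mX u wX -> comp_is mY u wY ->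
       comp_is mX v wX -> comp_is mY v wY -> lmap_eq u v).

(* Main.v *)
(* Let chi : X -> B be epic, proper and open, with left adjoint chi_! of chi^*,
   and let f : X -> R.  Put  rhoU q := chi_! f^*(q,oo)  and
   rhoD q := chi_* f^*(-oo,q).

   After general facts on frames, homomorphisms, the adjoints chi_* and chi_!,
   image sublocales and closed sublocales, the file proceeds in three steps.
   1. The assignment (q,oo) |-> rhoU q, (-oo,q) |-> rhoD q satisfies the relations of
      the frame of reals: the join relations come from chi_! preserving all
      joins and chi_* preserving directed joins (properness); disjointness from
      Frobenius reciprocity; the covering relations from closedness of chi and
      from epicness (chi_! 1 = 1, chi_* 0 = 0).  The presentation of R then gives
      rho : B -> R.
   2. In any pullback of a map along a map with a retraction (here (id, rho),
      retracted by the first product projection), the parallel leg is a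
      sublocale embedding: it factors through its own image.
   3. Let N := \/_q (f^*(-oo,q) /\ chi^*(rhoU q)).  On the closed sublocale X \ N
      the maps f and rho o chi agree, so X \ N -> X factors through the pullback
      M.  Since chi_* N = 0 (N is a directed join of finite joins, each killed by
      chi_* by induction on its size) and chi is closed, chi^* a \/ N <= chi^* b \/ N
      forces a <= b; hence M -> B reflects the order and is epic. *)

Require Import Defs.
From mathcomp Require Import all_boot all_order all_algebra.

Set Implicit Arguments.
Unset Strict Implicit.
Unset Printing Implicit Defensive.

Import Num.Theory.

Section FrameTheory.
Variable L : Frame.
Implicit Types a b c x y : L.

Lemma feq_refl x : x ≈ x.
Proof. by split; apply: le_refl. Qed.

Lemma feq_sym x y : x ≈ y -> y ≈ x.
Proof. by case. Qed.

Lemma feq_trans x y z : x ≈ y -> y ≈ z -> x ≈ z.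
Proof. by case=> xy yx [yz zy]; split; apply: le_trans; eauto. Qed.

Lemma top_feq x : le top x -> x ≈ top.
Proof. by move=> topx; split => //; apply: le_top. Qed.

Lemma bot_le x : le (@bot L) x.
Proof. by apply: join_lub. Qed.

Lemma le_join2_l a b : le a (join2 a b).
Proof. by apply: join_ub; left. Qed.

Lemma le_join2_r a b : le b (join2 a b).
Proof. by apply: join_ub; right. Qed.

Lemma join2_lub a b c : le a c -> le b c -> le (join2 a b) c.
Proof. by move=> ac bc; apply: join_lub => x [->|->]. Qed.

Lemma join2_mono a b a' b' : le a a' -> le b b' -> le (join2 a b) (join2 a' b').
Proof.
move=> aa' bb'; apply: join2_lub.
  exact: le_trans aa' (le_join2_l _ _).
exact: le_trans bb' (le_join2_r _ _).
Qed.

Lemma join2_comm a b : le (join2 a b) (join2 b a).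
Proof. by apply: join2_lub; [apply: le_join2_r | apply: le_join2_l]. Qed.

Lemma meet_mono a b a' b' : le a a' -> le b b' -> le (meet a b) (meet a' b').
Proof.
move=> aa' bb'; apply: meet_glb.
  exact: le_trans (meet_l _ _) aa'.
exact: le_trans (meet_r _ _) bb'.
Qed.

Lemma meet_comm a b : le (meet a b) (meet b a).
Proof. by apply: meet_glb; [apply: meet_r | apply: meet_l]. Qed.

Lemma distr2 a b c : le (meet a (join2 b c)) (join2 (meet a b) (meet a c)).
Proof.
apply: le_trans (distr _ _) _; apply: join_lub => y [x [->|->] ->].
  exact: le_join2_l.
exact: le_join2_r.
Qed.

Lemma join_le_join (S T : L -> Prop) :
  (forall x, S x -> exists2 y, T y & le x y) -> le (join S) (join T).
Proof.
by move=> ST; apply: join_lub => x /ST [y Ty xy]; apply: le_trans xy (join_ub Ty).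
Qed.

Lemma join_eq (S T : L -> Prop) :
  (forall x, S x -> exists2 y, T y & le x y) ->
  (forall y, T y -> exists2 x, S x & le y x) -> join S ≈ join T.
Proof. by move=> ST TS; split; apply: join_le_join. Qed.

Lemma join_img_img (I : Type) (K : Frame) (phi : K -> L) (k : I -> K) (P : I -> Prop) :
  join (img phi (img k P)) ≈ join (img (fun i => phi (k i)) P).
Proof.
apply: join_eq.
  by move=> _ [_ [i Pi ->] ->]; exists (phi (k i)); [exists i | apply: le_refl].
by move=> _ [i Pi ->]; exists (phi (k i)); [exists (k i) => //; exists i | apply: le_refl].
Qed.

Lemma join_exists (I : Type) (k : I -> L) :
  join (fun x => exists i, x = k i) ≈ join (img k (fun _ => True)).
Proof.
apply: join_eq.
  by move=> _ [i ->]; exists (k i); [exists i | apply: le_refl].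
by move=> _ [i _ ->]; exists (k i); [exists i | apply: le_refl].
Qed.

Lemma directed_chain (S : L -> Prop) :
  (exists x, S x) -> (forall x y, S x -> S y -> le x y \/ le y x) -> directed S.
Proof.
move=> ne tot; split => // x y Sx Sy.
by case: (tot x y Sx Sy) => xy; [exists y | exists x] => //; split => //; apply: le_refl.
Qed.

End FrameTheory.

Section FrameHomTheory.
Variables (A C : Frame) (h : FrameHom A C).

Lemma hfeq x y : x ≈ y -> h x ≈ h y.
Proof. by case=> xy yx; split; apply: hmono. Qed.

Lemma htop_le : le top (h top).
Proof. exact: proj2 (htop h). Qed.

Lemma hmeet_le a b : le (meet (h a) (h b)) (h (meet a b)).
Proof. exact: proj2 (hmeet h a b). Qed.

Lemma hbot : le (h bot) bot.
Proof. by apply: le_trans (proj1 (hjoin h _)) _; apply: join_lub => y [x []]. Qed.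

Lemma hjoin2 a b : h (join2 a b) ≈ join2 (h a) (h b).
Proof.
split; last by apply: join2_lub; apply: hmono; [apply: le_join2_l | apply: le_join2_r].
apply: le_trans (proj1 (hjoin h _)) _; apply: join_lub => y [x [->|->] ->].
  exact: le_join2_l.
exact: le_join2_r.
Qed.

Lemma directed_img (S : A -> Prop) : directed S -> directed (img h S).
Proof.
case=> [[x0 Sx0] updir]; split; first by exists (h x0); exists x0.
move=> _ _ [x Sx ->] [y Sy ->]; have [z Sz [xz yz]] := updir x y Sx Sy.
by exists (h z); [exists z | split; apply: hmono].
Qed.

End FrameHomTheory.

(* g o h; as locale maps this is the composite in the opposite order. *)
Definition hcomp {A B C : Frame} (g : FrameHom B C) (h : FrameHom A B) : FrameHom A C.
Proof.
refine (@Build_FrameHom A C (fun x => g (h x)) _ _ _ _).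
- by move=> x y xy; do 2 apply: hmono.
- by apply: top_feq; apply: le_trans (htop_le g) _; apply: hmono; apply: htop_le.
- move=> x y; split; last by apply: le_trans (hmeet_le g _ _) _; apply: hmono; apply: hmeet_le.
  by apply: le_trans _ (proj1 (hmeet g _ _)); apply: hmono; exact: proj1 (hmeet h _ _).
- move=> S; apply: feq_trans (hfeq g (hjoin h S)) _.
  exact: feq_trans (hjoin g _) (join_img_img _ _ _).
Defined.

Section Adjoints.
Variables (X Y : Locale) (chi : LMap X Y).

Lemma dir_adj a b : le (chi b) a -> le b (dirimg chi a).
Proof. by move=> h; apply: join_ub. Qed.

Lemma dir_unit b : le b (dirimg chi (chi b)).
Proof. by apply: dir_adj; apply: le_refl. Qed.

Lemma dir_counit a : le (chi (dirimg chi a)) a.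
Proof. by apply: le_trans (proj1 (hjoin chi _)) _; apply: join_lub => _ [x Hx ->]. Qed.

Lemma dir_mono a a' : le a a' -> le (dirimg chi a) (dirimg chi a').
Proof. by move=> aa'; apply: dir_adj; apply: le_trans (dir_counit _) aa'. Qed.

Lemma dir_feq a a' : a ≈ a' -> dirimg chi a ≈ dirimg chi a'.
Proof. by case=> h1 h2; split; apply: dir_mono. Qed.

Lemma dir_meet a b : le (meet (dirimg chi a) (dirimg chi b)) (dirimg chi (meet a b)).
Proof.
apply: dir_adj; apply: le_trans (proj1 (hmeet chi _ _)) _.
by apply: meet_mono; apply: dir_counit.
Qed.

Lemma dir_top : le top (dirimg chi top).
Proof. by apply: dir_adj; apply: le_top. Qed.

(* For an epimorphism chi^* is injective, so chi_* o chi^* = id. *)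
Lemma dir_epic : epic chi -> forall b, le (dirimg chi (chi b)) b.
Proof.
move=> chi_epic b; have: chi (dirimg chi (chi b)) ≈ chi b.
  by split; [apply: dir_counit | apply: hmono; apply: dir_unit].
by move/chi_epic => [].
Qed.

Lemma dir_bot : epic chi -> le (dirimg chi bot) bot.
Proof.
move=> chi_epic; apply: le_trans (dir_epic chi_epic bot).
by apply: dir_mono; apply: bot_le.
Qed.

Variable sh : O X -> O Y.
Hypothesis adj : left_adjoint chi sh.

Lemma sh_unit a : le a (chi (sh a)).
Proof. by apply/adj; apply: le_refl. Qed.

Lemma sh_mono a a' : le a a' -> le (sh a) (sh a').
Proof. by move=> aa'; apply/adj; apply: le_trans aa' (sh_unit _). Qed.

Lemma sh_feq a a' : a ≈ a' -> sh a ≈ sh a'.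
Proof. by case=> h1 h2; split; apply: sh_mono. Qed.

Lemma sh_join (S : O X -> Prop) : sh (join S) ≈ join (img sh S).
Proof.
split; last by apply: join_lub => _ [x Sx ->]; apply: sh_mono; apply: join_ub.
apply/adj; apply: join_lub => x Sx; apply: le_trans (sh_unit x) _.
by apply: hmono; apply: join_ub; exists x.
Qed.

Lemma sh_bot : le (sh bot) bot.
Proof. by apply/adj; apply: bot_le. Qed.

Lemma sh_top : epic chi -> le top (sh top).
Proof.
move=> chi_epic; have: chi (sh top) ≈ chi top.
  split; first by apply: le_trans (le_top _) (htop_le chi).
  exact: le_trans (le_top _) (sh_unit _).
by move/chi_epic => [_ h]; apply: le_trans (le_top _) h.
Qed.

End Adjoints.

(* The image of a frame homomorphism m : O X -> O M is a subframe of O M;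
   as a locale it is the image sublocale of the locale map m : M -> X. *)
Section ImageSublocale.
Variables (M X : Frame) (m : FrameHom X M).

Definition in_image (a : M) : Prop := exists b, m b ≈ a.
Definition ImC := {a : M | in_image a}.

Lemma im_top_pf : in_image top.
Proof. by exists top; apply: htop. Qed.

Lemma im_meet_pf (a b : ImC) : in_image (meet (sval a) (sval b)).
Proof.
case: a => [a [a' [aa' a'a]]]; case: b => [b [b' [bb' b'b]]] /=.
exists (meet a' b'); apply: feq_trans (hmeet m _ _) _.
by split; apply: meet_mono.
Qed.

Lemma im_join_pf (S : ImC -> Prop) : in_image (join (img (@sval _ _) S)).
Proof.
exists (join (fun b => exists2 x : ImC, S x & m b ≈ sval x)).
apply: feq_trans (hjoin m _) _; apply: join_eq.
  by move=> _ [b [x Sx [bx _]] ->]; exists (sval x) => //; exists x.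
move=> _ [x Sx ->]; case: (svalP x) => b [bx xb].
by exists (m b) => //; exists b => //; exists x.
Qed.

Definition im_meet (a b : ImC) : ImC := exist _ _ (im_meet_pf a b).

Definition ImF : Frame.
Proof.
refine (@Build_Frame ImC (fun a b => le (sval a) (sval b)) _ _
  (exist _ top im_top_pf) _ im_meet _ _ _ (fun S => exist _ _ (im_join_pf S)) _ _ _).
- by move=> x; apply: le_refl.
- by move=> x y z; apply: le_trans.
- by move=> x; apply: le_top.
- by move=> x y; apply: meet_l.
- by move=> x y; apply: meet_r.
- by move=> x y z; apply: meet_glb.
- by move=> S x Sx; apply: join_ub; exists x.
- by move=> S y H; apply: join_lub => _ [x Sx ->]; apply: H.
- move=> a S /=; apply: le_trans (distr _ _) _.
  apply: join_lub => _ [_ [z Sz ->] ->]; apply: join_ub.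
  by exists (im_meet a z) => //; exists z.
Defined.

Definition corestrict (A : Frame) (h : FrameHom A M) (pf : forall a, in_image (h a)) :
  FrameHom A ImF.
Proof.
refine (@Build_FrameHom A ImF (fun a => exist _ (h a) (pf a)) _ _ _ _).
- by move=> x y xy; apply: hmono.
- exact: htop h.
- by move=> x y; apply: hmeet h x y.
- move=> S; apply: feq_trans (hjoin h S) _; apply: join_eq.
    move=> _ [x Sx ->]; exists (h x); last exact: le_refl.
    by exists (exist _ (h x) (pf x)) => //; exists x.
  by move=> _ [_ [x Sx ->] ->]; exists (h x); [exists x | apply: le_refl].
Defined.

Definition image_incl : FrameHom ImF M.
Proof.
refine (@Build_FrameHom ImF M (fun a => sval a) _ _ _ _) => //.
- exact: feq_refl.
- by move=> x y; apply: feq_refl.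
- by move=> S; apply: feq_refl.
Defined.

End ImageSublocale.

(* In a pullback of cf along a map idrho that has a retraction p1, the leg mX
   parallel to idrho is a sublocale embedding: mB factors through the image of
   mX^*, so the image sublocale is a competing cone, and the induced endomap
   of M through the image is the identity. *)
Lemma pullback_embedding (X B P M : Locale) (cf : LMap X P) (idrho : LMap B P)
  (p1 : LMap P B) (retr : comp_is p1 idrho (lid B))
  (mX : LMap M X) (mB : LMap M B) :
  is_pullback cf idrho mX mB -> sublocale_embedding mX.
Proof.
case=> comm univ.
have inX a : in_image mX (mX a) by exists a; apply: feq_refl.
have inB a : in_image mX (mB a).
  by exists (cf (p1 a)); apply: feq_trans (comm _) (hfeq mB (retr a)).
have [[u [u1 u2]] _] := univ _ (corestrict inX) (corestrict inB) (fun c => comm c).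
have [_ uniq] := univ _ mX mB comm.
have u_id : lmap_eq (hcomp (image_incl mX) u) (lid M).
  by apply: uniq => c; [apply: u1 | apply: u2 | apply: feq_refl | apply: feq_refl].
move=> a; case: (svalP (u a)) => b Hb.
by exists b; apply: feq_trans Hb (u_id a).
Qed.

(* The closed sublocale X \ N : its frame is the up-set of N, and the
   embedding sends x to x \/ N. *)
Section ClosedSublocale.
Variables (X : Frame) (N : X).

Definition UpC := {a : X | le N a}.

Definition up_meet (a b : UpC) : UpC :=
  exist _ (meet (sval a) (sval b)) (meet_glb (svalP a) (svalP b)).

Definition ClF : Frame.
Proof.
refine (@Build_Frame UpC (fun a b => le (sval a) (sval b)) _ _
  (exist _ top (le_top N)) _ up_meet _ _ _
  (fun S => exist _ (join2 N (join (img (@sval _ _) S))) (le_join2_l _ _)) _ _ _).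
- by move=> x; apply: le_refl.
- by move=> x y z; apply: le_trans.
- by move=> x; apply: le_top.
- by move=> x y; apply: meet_l.
- by move=> x y; apply: meet_r.
- by move=> x y z; apply: meet_glb.
- by move=> S x Sx; apply: le_trans (le_join2_r _ _); apply: join_ub; exists x.
- move=> S y H; apply: join2_lub; first exact: (svalP y).
  by apply: join_lub => _ [x Sx ->]; apply: H.
- move=> a S /=; apply: le_trans (distr2 _ _ _) _.
  apply: join2_mono; first exact: meet_r.
  apply: le_trans (distr _ _) _; apply: join_lub => _ [_ [z Sz ->] ->].
  by apply: join_ub; exists (up_meet a z) => //; exists z.
Defined.

Lemma join2_N_meet x y : le (meet (join2 x N) (join2 y N)) (join2 (meet x y) N).
Proof.
apply: le_trans (distr2 _ _ _) _; apply: join2_lub; last first.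
  exact: le_trans (meet_r _ _) (le_join2_r _ _).
apply: le_trans (meet_comm _ _) _; apply: le_trans (distr2 _ _ _) _.
apply: join2_lub; last exact: le_trans (meet_r _ _) (le_join2_r _ _).
exact: le_trans (meet_comm _ _) (le_join2_l _ _).
Qed.

Definition closed_incl : FrameHom X ClF.
Proof.
refine (@Build_FrameHom X ClF (fun x => exist _ (join2 x N) (le_join2_r _ _)) _ _ _ _).
- by move=> x y xy; apply: join2_mono => //; apply: le_refl.
- by split; [apply: le_top | apply: le_join2_l].
- move=> x y; split; last exact: join2_N_meet.
  by apply: meet_glb; apply: join2_mono; try apply: le_refl; [apply: meet_l | apply: meet_r].
- move=> S; split => /=.
    apply: join2_lub; last exact: le_join2_l.
    apply: join_lub => x Sx; apply: le_trans _ (le_join2_r _ _).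
    apply: le_trans (le_join2_l x N) (join_ub _).
    by exists (exist _ (join2 x N) (le_join2_r _ _)) => //; exists x.
  apply: join2_lub; first exact: le_join2_r.
  apply: join_lub => _ [_ [x Sx ->] ->] /=; apply: join2_mono; last exact: le_refl.
  exact: join_ub.
Defined.

End ClosedSublocale.

Lemma seq_max (d : Order.disp_t) (T : orderType d) (y : T) (F : seq T) :
  exists2 m, m \in y :: F & forall q, q \in y :: F -> (q <= m)%O.
Proof.
elim: F y => [|z F IH] y.
  by exists y; rewrite ?mem_head // => q; rewrite inE => /eqP ->.
have [m mF m_max] := IH z.
case/orP: (Order.TotalTheory.le_total y m) => [ym|my].
  exists m; first by rewrite inE mF orbT.
  by move=> q; rewrite inE => /orP [/eqP ->|/m_max].
exists y; first exact: mem_head.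
move=> q; rewrite inE => /orP [/eqP ->|/m_max qm] //.
exact: Order.POrderTheory.le_trans qm my.
Qed.

Section RealsGenerators.
Variable R : RealsLocale.
Local Open Scope ring_scope.

Lemma down_le (p q : rat) : p <= q -> le (gen R (Down p)) (gen R (Down q)).
Proof.
rewrite Order.POrderTheory.le_eqVlt => /orP [/eqP ->|pq]; first exact: le_refl.
case: (gen_rel R) => _ [down_join _].
by apply: le_trans (proj2 (down_join q)); apply: join_ub; exists p.
Qed.

Lemma down_directed (P : rat -> Prop) :
  (exists p, P p) -> directed (img (fun p => gen R (Down p)) P).
Proof.
case=> p Pp; apply: directed_chain; first by exists (gen R (Down p)); exists p.
move=> _ _ [p1 _ ->] [p2 _ ->].
by case/orP: (Order.TotalTheory.le_total p1 p2) => h; [left | right]; apply: down_le.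
Qed.

End RealsGenerators.

Section Construction.
Local Open Scope ring_scope.
Variables (R : RealsLocale) (X B : Locale) (chi : LMap X B) (sh : O X -> O B).
Hypotheses (chi_epic : epic chi) (chi_proper : proper_map chi)
  (adj : left_adjoint chi sh) (frob : frobenius chi sh).
Variable f : LMap X R.

Definition fU q := f (gen R (Up q)).
Definition fD q := f (gen R (Down q)).
Definition rhoU q := sh (fU q).
Definition rhoD q := dirimg chi (fD q).

Definition rho_gen (x : RGen) : O B :=
  match x with Up q => rhoU q | Down q => rhoD q end.

(* chi_! preserves all joins, so the join relation for (p,oo) transfers. *)
Lemma rhoU_join p : rhoU p ≈ join (img rhoU (fun q => p < q)).
Proof.
case: (gen_rel R) => up_join _.
apply: feq_trans (sh_feq adj (hfeq f (up_join p))) _.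
apply: feq_trans (sh_feq adj (hjoin f _)) _.
apply: feq_trans (sh_join adj _) _.
exact: feq_trans (join_img_img _ _ _) (join_img_img _ _ _).
Qed.

(* Properness is what lets chi_* commute with the directed join (-oo,q) = \/_{p<q} (-oo,p). *)
Lemma rhoD_join q : rhoD q ≈ join (img rhoD (fun p => p < q)).
Proof.
case: (gen_rel R) => _ [down_join _].
apply: feq_trans (dir_feq chi (hfeq f (down_join q))) _.
apply: feq_trans (dir_feq chi (hjoin f _)) _.
have below_q : exists p : rat, p < q by exists (q - 1); rewrite gtrBl ltr01.
apply: feq_trans (proj2 chi_proper _ (directed_img f (down_directed R below_q))) _.
exact: feq_trans (join_img_img _ _ _) (join_img_img _ _ _).
Qed.

(* chi_! 1 = 1 because chi is epic, and chi_! preserves the join \/_q (q,oo) = 1. *)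
Lemma rhoU_cover : join (fun x => exists q, x = rhoU q) ≈ top.
Proof.
case: (gen_rel R) => _ [_ [up_cover _]].
apply: top_feq; apply: le_trans (sh_top adj chi_epic) _.
apply: le_trans (sh_mono adj (htop_le f)) _.
apply: le_trans (sh_mono adj (hmono f (proj2 up_cover))) _.
apply: le_trans (sh_mono adj (hmono f (proj1 (join_exists _)))) _.
apply: le_trans (proj1 (sh_feq adj (hjoin f _))) _.
apply: le_trans (proj1 (sh_join adj _)) _.
apply: le_trans (proj1 (feq_trans (join_img_img _ _ _) (join_img_img _ _ _))) _.
exact: proj2 (join_exists _).
Qed.

(* chi_* 1 = 1, and chi_* preserves the directed join \/_q (-oo,q) = 1. *)
Lemma rhoD_cover : join (fun x => exists q, x = rhoD q) ≈ top.
Proof.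
case: (gen_rel R) => _ [_ [_ [down_cover _]]].
apply: top_feq; apply: le_trans (dir_top chi) _.
apply: le_trans (dir_mono chi (htop_le f)) _.
apply: le_trans (dir_mono chi (hmono f (proj2 down_cover))) _.
apply: le_trans (dir_mono chi (hmono f (proj1 (join_exists _)))) _.
apply: le_trans (proj1 (dir_feq chi (hjoin f _))) _.
have some_p : exists p : rat, True by exists 0.
apply: le_trans (proj1 (proj2 chi_proper _ (directed_img f (down_directed R some_p)))) _.
apply: le_trans (proj1 (feq_trans (join_img_img _ _ _) (join_img_img _ _ _))) _.
exact: proj2 (join_exists _).
Qed.

(* Disjointness via Frobenius reciprocity: chi_* a /\ chi_! b = chi_!(chi^* chi_* a /\ b). *)
Lemma rho_disjoint p q : q <= p -> le (meet (rhoD q) (rhoU p)) bot.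
Proof.
move=> qp; case: (gen_rel R) => _ [_ [_ [_ [disj _]]]].
apply: le_trans (proj2 (frob _ _)) _.
apply: le_trans (sh_bot adj); apply: (sh_mono adj).
apply: le_trans (hbot f); apply: le_trans _ (hmono f (proj1 (disj p q qp))).
apply: le_trans _ (hmeet_le f _ _); apply: meet_mono; last exact: le_refl.
exact: dir_counit.
Qed.

(* Covering via closedness: chi_*(chi^* chi_! b \/ a) = chi_! b \/ chi_* a. *)
Lemma rho_cover p q : p < q -> join2 (rhoD q) (rhoU p) ≈ top.
Proof.
move=> pq; case: (gen_rel R) => _ [_ [_ [_ [_ cover]]]].
apply: top_feq; apply: le_trans (dir_top chi) _.
apply: le_trans _ (join2_comm _ _).
apply: le_trans _ (proj1 (proj1 chi_proper (fD q) (rhoU p))).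
apply: dir_mono; apply: le_trans (htop_le f) _.
apply: le_trans (hmono f (proj2 (cover p q pq))) _.
apply: le_trans (proj1 (hjoin2 f _ _)) _.
apply: le_trans (join2_comm _ _) _.
by apply: join2_mono; [apply: sh_unit | apply: le_refl].
Qed.

Lemma rho_relations : reals_relations rho_gen.
Proof.
split; first exact: rhoU_join.
split; first exact: rhoD_join.
split; first exact: rhoU_cover.
split; first exact: rhoD_cover.
split; last exact: rho_cover.
by move=> p q qp; split; [apply: rho_disjoint | apply: bot_le].
Qed.

(* The part of X where f and rho o chi may disagree: N = \/_q f^*(-oo,q) /\ chi^* rho^*(q,oo),
   and its finite subjoins. *)
Definition slice q := meet (fD q) (chi (rhoU q)).
Definition N : O X := join (img slice (fun _ => True)).
Definition Nfin (F : seq rat) : O X := join (img slice (fun q => q \in F)).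

Lemma fD_mono p q : p <= q -> le (fD p) (fD q).
Proof. by move=> pq; apply: hmono; apply: down_le. Qed.

Lemma Nfin_le_fD F m : (forall q, q \in F -> q <= m) -> le (Nfin F) (fD m).
Proof.
move=> F_le_m; apply: join_lub => _ [q qF ->].
exact: le_trans (meet_l _ _) (fD_mono (F_le_m q qF)).
Qed.

(* Meeting with chi^* rho^*(-oo,m) kills the slice at the maximum m, since
   rho^*(-oo,m) /\ rho^*(m,oo) = 0. *)
Lemma Nfin_strip F m : (forall q, q \in F -> q <= m) ->
  le (meet (Nfin F) (chi (rhoD m))) (Nfin [seq q <- F | q < m]).
Proof.
move=> F_le_m; apply: le_trans (meet_comm _ _) _; apply: le_trans (distr _ _) _.
apply: join_lub => _ [_ [q qF ->] ->].
case qm: (q < m).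
  apply: le_trans (meet_r _ _) _; apply: join_ub; exists q => //.
  by rewrite mem_filter qm.
have -> : q = m.
  apply: Order.POrderTheory.le_anti.
  by rewrite F_le_m //= Order.TotalTheory.leNgt qm.
apply: le_trans _ (bot_le _); apply: le_trans _ (hbot chi).
apply: le_trans _ (hmono chi (rho_disjoint (Order.POrderTheory.lexx m))).
apply: le_trans _ (hmeet_le chi _ _).
by apply: meet_mono; [apply: le_refl | apply: meet_r].
Qed.

Lemma dir_Nfin n F : (size F <= n)%N -> le (dirimg chi (Nfin F)) bot.
Proof.
have nil_bot : le (dirimg chi (Nfin [::])) bot.
  apply: le_trans (dir_bot chi_epic); apply: dir_mono.
  by apply: join_lub => x [q].
elim: n F => [|n IH] [|y F0] // sizeF.
set F := y :: F0 in sizeF *.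
have [m mF m_max] := seq_max y F0.
have sizeF' : (size [seq q <- F | (q < m)%R] <= n)%N.
  rewrite size_filter -ltnS; apply: leq_trans sizeF.
  rewrite -(count_predC (fun q => q < m) F) -{1}[count _ F]addn0 ltn_add2l -has_count.
  by apply/hasP; exists m => //=; rewrite Order.POrderTheory.ltxx.
apply: le_trans (IH _ sizeF').
apply: le_trans _ (dir_mono chi (Nfin_strip m_max)).
apply: le_trans _ (dir_meet chi _ _).
apply: meet_glb; first exact: le_refl.
exact: le_trans (dir_mono chi (Nfin_le_fD m_max)) (dir_unit _ _).
Qed.

(* N is the directed join of its finite subjoins, and chi_* preserves it. *)
Lemma dir_N : le (dirimg chi N) bot.
Proof.
have fin_directed : directed (img Nfin (fun _ => True)).
  split; first by exists (Nfin [::]); exists [::].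
  move=> _ _ [F _ ->] [G _ ->]; exists (Nfin (F ++ G)); first by exists (F ++ G).
  split; apply: join_le_join => _ [q qF ->]; exists (slice q); try exact: le_refl;
    by exists q; rewrite // mem_cat qF ?orbT.
have N_fin : le N (join (img Nfin (fun _ => True))).
  apply: join_lub => _ [q _ ->]; apply: le_trans _ (join_ub _); last by exists [:: q].
  by apply: join_ub; exists q; rewrite ?mem_head.
apply: le_trans (dir_mono chi N_fin) _.
apply: le_trans (proj1 (proj2 chi_proper _ fin_directed)) _.
by apply: join_lub => _ [_ [F _ ->] ->]; apply: dir_Nfin (leqnn _).
Qed.

(* On the closed complement of N, chi^* still reflects the order:
   chi_*(chi^* b \/ N) = b \/ chi_* N = b by closedness. *)
Lemma reflect_mod_N a b : le (join2 (chi a) N) (join2 (chi b) N) -> le a b.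
Proof.
move=> ab; apply: le_trans (dir_unit chi a) _.
apply: le_trans (dir_mono chi (le_trans (le_join2_l _ N) ab)) _.
apply: le_trans (proj1 (proj1 chi_proper N b)) _.
by apply: join2_lub; [apply: le_refl | apply: le_trans dir_N (bot_le _)].
Qed.

(* For q < r, the cover (-oo,r) \/ (q,oo) = 1 splits chi^* rho^*(r,oo) into a slice of N
   and a part below f^*(q,oo). *)
Lemma chi_rhoU_le q r : q < r -> le (chi (rhoU r)) (join2 (fU q) N).
Proof.
move=> qr; case: (gen_rel R) => _ [_ [_ [_ [_ cover]]]].
apply: le_trans (meet_glb (le_refl _) (le_trans (le_top _) (htop_le f))) _.
apply: le_trans (meet_mono (le_refl _) (hmono f (proj2 (cover q r qr)))) _.
apply: le_trans (meet_mono (le_refl _) (proj1 (hjoin2 f _ _))) _.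
apply: le_trans (distr2 _ _ _) _; apply: le_trans _ (join2_comm _ _).
apply: join2_mono; last exact: meet_r.
by apply: le_trans (meet_comm _ _) _; apply: join_ub; exists r.
Qed.

(* Dually, for p < q the cover rho^*(-oo,q) \/ rho^*(p,oo) = 1 splits f^*(-oo,p). *)
Lemma fD_le p q : p < q -> le (fD p) (join2 (chi (rhoD q)) N).
Proof.
move=> pq; apply: le_trans (meet_glb (le_refl _) (le_trans (le_top _) (htop_le chi))) _.
apply: le_trans (meet_mono (le_refl _) (hmono chi (proj2 (rho_cover pq)))) _.
apply: le_trans (meet_mono (le_refl _) (proj1 (hjoin2 chi _ _))) _.
apply: le_trans (distr2 _ _ _) _.
by apply: join2_mono; [apply: meet_r | apply: join_ub; exists p].
Qed.

Lemma agree_mod_N (x : RGen) : join2 (f (gen R x)) N ≈ join2 (chi (rho_gen x)) N.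
Proof.
case: x => q; split.
- by apply: join2_mono; [apply: sh_unit | apply: le_refl].
- apply: join2_lub; last exact: le_join2_r.
  apply: le_trans (hmono chi (proj1 (rhoU_join q))) _.
  apply: le_trans (proj1 (hjoin chi _)) _.
  by apply: join_lub => _ [_ [r qr ->] ->]; apply: chi_rhoU_le.
- apply: join2_lub; last exact: le_join2_r.
  case: (gen_rel R) => _ [down_join _].
  apply: le_trans (hmono f (proj1 (down_join q))) _.
  apply: le_trans (proj1 (hjoin f _)) _.
  by apply: join_lub => _ [_ [p pq ->] ->]; apply: fD_le.
- by apply: join2_mono; [apply: dir_counit | apply: le_refl].
Qed.

Variable rho : LMap B R.
Hypothesis rho_on_gen : forall x, rho (gen R x) ≈ rho_gen x.

Lemma agree_on_complement (a : O R) :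
  hcomp (closed_incl N) f a ≈ hcomp (closed_incl N) (hcomp chi rho) a.
Proof.
apply: gen_uniq => x; case: (agree_mod_N x) => fx xf.
case: (hfeq chi (rho_on_gen x)) => h1 h2; split => /=.
  by apply: le_trans fx _; apply: join2_mono; [apply: h2 | apply: le_refl].
by apply: le_trans _ xf; apply: join2_mono; [apply: h1 | apply: le_refl].
Qed.

Section Pullback.
Variables (P : Locale) (p1 : LMap P B) (p2 : LMap P R).
Hypothesis p_product : is_product p1 p2.
Variables (cf : LMap X P) (idrho : LMap B P).
Hypotheses (cf1 : comp_is p1 cf chi) (cf2 : comp_is p2 cf f)
  (idrho1 : comp_is p1 idrho (lid B)) (idrho2 : comp_is p2 idrho rho).
Variables (M : Locale) (mX : LMap M X) (mB : LMap M B).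
Hypothesis pb : is_pullback cf idrho mX mB.

Lemma complement_to_pullback :
  exists u : LMap (ClF N) M, comp_is mB u (hcomp (closed_incl N) chi).
Proof.
set w := closed_incl N; set z1 := hcomp w chi; set z2 := hcomp w f.
have [_ prod_uniq] := p_product z1 z2.
have square : lmap_eq (hcomp w cf) (hcomp z1 idrho).
  apply: prod_uniq => [c|c|c|c].
  - exact (hfeq w (cf1 c)).
  - exact (hfeq w (cf2 c)).
  - exact (hfeq w (hfeq chi (idrho1 c))).
  - exact (feq_trans (hfeq w (hfeq chi (idrho2 c))) (feq_sym (agree_on_complement c))).
have [[u [_ u2]] _] := proj2 pb _ w z1 square.
by exists u.
Qed.

(* Through X \ N -> M, the order on mB^* b is that of chi^* b \/ N, which reflects b. *)
Lemma pullback_epic : epic mB.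
Proof.
have [u u2] := complement_to_pullback.
have mB_reflects a b : le (mB a) (mB b) -> le a b.
  move=> ab; apply: reflect_mod_N.
  exact: le_trans (proj2 (u2 a)) (le_trans (hmono u ab) (proj1 (u2 b))).
by move=> a b [ab ba]; split; apply: mB_reflects.
Qed.

End Pullback.
End Construction.

Theorem mainTheorem2 (R : RealsLocale) (X B : Locale)
  (chi : LMap X B) (chi_shriek : O X -> O B)
  (chi_epic : epic chi) (chi_proper : proper_map chi)
  (chi_open_adj : left_adjoint chi chi_shriek)
  (chi_open_frob : frobenius chi chi_shriek)
  (f : LMap X R) :
  exists rho : LMap B R,
    (forall q : rat,
        invimg rho (gen R (Up q)) ≈ chi_shriek (invimg f (gen R (Up q))) /\
        invimg rho (gen R (Down q)) ≈ dirimg chi (invimg f (gen R (Down q)))) /\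
    (forall (P : Locale) (p1 : LMap P B) (p2 : LMap P R),
       is_product p1 p2 ->
       forall (cf : LMap X P) (idrho : LMap B P),
         (* cf = (chi, f) *)
         comp_is p1 cf chi -> comp_is p2 cf f ->
         (* idrho = (id_B, rho) *)
         comp_is p1 idrho (lid B) -> comp_is p2 idrho rho ->
         forall (M : Locale) (mX : LMap M X) (mB : LMap M B),
           is_pullback cf idrho mX mB ->
           sublocale_embedding mX /\ epic mB).
Proof.
have rels := rho_relations chi_epic chi_proper chi_open_adj chi_open_frob f.
have [rho rho_on_gen] := @gen_univ R _ _ rels.
exists rho; split.
  by move=> q; split; [apply: (rho_on_gen (Up q)) | apply: (rho_on_gen (Down q))].
move=> P p1 p2 prod cf idrho cf1 cf2 idrho1 idrho2 M mX mB pb; split.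
  exact (pullback_embedding idrho1 pb).
exact (pullback_epic chi_epic chi_proper chi_open_adj chi_open_frob
  rho_on_gen prod cf1 cf2 idrho1 idrho2 pb).
Qed.
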